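(* Let $n,m\ge1$ be integers and consider a star junction with $n$ joining pipes $P_1,\dots,P_n$ connecting to $m$ branching pipes $P_{n+1},\dots,P_{n+m}$. Let $p_{j,r},q_{j,\ell},p_{j,\ell},q_{j,r}$ ($j=1,\dots,n+m$) be real-valued functions of time, with $p_{j,r}$ and $q_{j,\ell}$ differentiable, satisfying $$\dot p_{j,r}=\alpha_j(q_{j,r}-q_{j,\ell}),\qquad \dot q_{j,\ell}=\beta_j p_{j,r}+\kappa_j p_{j,\ell}+\gamma_j q_{j,\ell},\qquad j=1,\dots,n+m,$$ and the matching conditions $$p_{1,r}=\dots=p_{n,r}=p_{n+1,\ell}=\dots=p_{n+m,\ell},\qquad q_{1,r}+\dots+q_{n,r}=q_{n+1,\ell}+\dots+q_{n+m,\ell}.$$ Then the internal variables $q_{k,r}$, $k\in\{1,\dots,n\}$, and $p_{j,\ell}$, $j\in\{n+1,\dots,n+m\}$, are expressed through the state variables $q_{i,\ell}$, $i\in\{1,\dots,n+m\}$, and $p_{1,r}$ by $$\left(\sum_{j=1}^n\prod_{\substack{i=1\\ i\neq j}}^n\alpha_i\right)q_{k,r}=\prod_{\substack{i=1\\ i\neq k}}^n\alpha_i\left(\sum_{i=n+1}^{n+m}q_{i,\ell}-\sum_{\substack{i=1\\ i\neq k}}^n q_{i,\ell}\right)+\left(\sum_{j=1}^n\prod_{\substack{i=1\\ i\neq j}}^n\alpha_i-\prod_{\substack{i=1\\ i\neq k}}^n\alpha_i\right)q_{k,\ell},$$ $$p_{j,\ell}=p_{1,r}.$$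
   Context: For pipe $P_j$, $p_{j,\ell},p_{j,r}$ are the (deviations of) pressures at the left and right ends, and $q_{j,\ell},q_{j,r}$ the (deviations of) mass flows at the left and right ends. The coefficients $\alpha_j,\beta_j,\kappa_j,\gamma_j$ are real constants; in the application $\alpha_j=-\frac{R_sT_0z_0}{A_jX_j}<0$ and $\beta_j=-\frac{A_j}{X_j}<0$, where $R_s,T_0,z_0,A_j,X_j>0$ (specific gas constant, temperature, compressibility factor, cross-sectional area, length). Empty products equal $1$. *)

(* Defs.v *)
From HB Require Import structures.
From mathcomp Require Import all_boot all_order all_algebra.
From mathcomp Require Import all_classical all_reals all_analysis.

Set Implicit Arguments.
Unset Strict Implicit.
Unset Printing Implicit Defensive.

Import Order.TTheory GRing.Theory Num.Theory.
Import numFieldNormedType.Exports.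

Local Open Scope classical_set_scope.
Local Open Scope ring_scope.

(* Pipes are indexed by 'I_(n + m): the joining pipes are lshift m i for
   i : 'I_n, the branching pipes are rshift n j for j : 'I_m.  Below, pl, pr,
   ql, qr are the families of functions of time p_{j,l}, p_{j,r}, q_{j,l},
   q_{j,r}, and T is the set of times under consideration. *)

Definition pipe_dynamics (R : realType) (N : nat)
    (alpha beta kappa gamma : 'I_N -> R) (T : set R)
    (pl pr ql qr : 'I_N -> R -> R) : Prop :=
  forall (j : 'I_N) (t : R), T t ->
    [/\ derivable (pr j) t 1,
        derivable (ql j) t 1,
        derive1 (pr j) t = alpha j * (qr j t - ql j t) &
        derive1 (ql j) t = beta j * pr j t + kappa j * pl j t + gamma j * ql j t].

Definition star_matching (R : realType) (n m : nat) (T : set R)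
    (pl pr ql qr : 'I_(n + m) -> R -> R) : Prop :=
  forall t : R, T t ->
    [/\ forall i i' : 'I_n, pr (lshift m i) t = pr (lshift m i') t,
        forall (i : 'I_n) (j : 'I_m), pr (lshift m i) t = pl (rshift n j) t &
        \sum_(i < n) qr (lshift m i) t = \sum_(j < m) ql (rshift n j) t].

(* Main.v *)
(* The pressures p_{i,r} of the joining pipes coincide on an open set of times,
   so their derivatives alpha_i x_i, with x_i = q_{i,r} - q_{i,l}, coincide too.
   Hence (prod_{i != j} alpha_i) x_k = (prod_{i != k} alpha_i) x_j, also when some
   alpha_i vanish; summing over j and using flow conservation gives the formula. *)

Require Import Defs.
From HB Require Import structures.
From mathcomp Require Import all_boot all_order all_algebra.
From mathcomp Require Import all_classical all_reals all_analysis.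
From mathcomp Require Import ring.

Set Implicit Arguments.
Unset Strict Implicit.
Unset Printing Implicit Defensive.

Import Order.TTheory GRing.Theory Num.Theory.
Import numFieldNormedType.Exports.

Local Open Scope classical_set_scope.
Local Open Scope ring_scope.

(** A derivative depends only on the germ at [t], and the open set [T] is a neighbourhood of [t]. *)
Lemma derive1_eq_on_open (R : realType) (T : set R) (f g : R -> R) (t : R) :
  open T -> {in T, f =1 g} -> T t -> derive1 f t = derive1 g t.
Proof.
move=> hT fg Tt; rewrite !derive1E; apply: near_eq_derive.
by near=> x; apply: fg; rewrite inE; near: x; exact: open_nbhs_nbhs.
Unshelve. all: by end_near. Qed.

(** For [j != k], both sides are the product of the [a i] with [i] outside [{j, k}], times
    [a k * x k] on the left and [a j * x j] on the right. No division occurs. *)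
Lemma prod_except_cross (R : comPzRingType) (I : finType) (a x : I -> R) :
  (forall i j, a i * x i = a j * x j) ->
  forall j k, (\prod_(i | i != j) a i) * x k = (\prod_(i | i != k) a i) * x j.
Proof.
move=> ax j k; have [->//|jk] := eqVneq j k.
rewrite (bigD1 k) 1?eq_sym //= [in RHS](bigD1 j) //=.
rewrite mulrAC (ax k j) mulrAC; congr (_ * _ * _).
by apply: eq_bigl => i; rewrite andbC.
Qed.

Lemma sum_prod_except (R : comPzRingType) (I : finType) (a x : I -> R) (k : I) :
  (forall i j, a i * x i = a j * x j) ->
  (\sum_j \prod_(i | i != j) a i) * x k
    = (\prod_(i | i != k) a i) * \sum_j x j.
Proof.
move=> ax; rewrite mulr_suml mulr_sumr.
by apply: eq_bigr => j _; exact: prod_except_cross.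
Qed.

Theorem corollary1 (R : realType) (n m : nat) (hn : (0 < n)%N) (hm : (0 < m)%N)
    (alpha beta kappa gamma : 'I_(n + m) -> R)
    (T : set R) (hT : open T)
    (pl pr ql qr : 'I_(n + m) -> R -> R)
    (hdyn : pipe_dynamics alpha beta kappa gamma T pl pr ql qr)
    (hmatch : star_matching T pl pr ql qr) :
  forall t : R, T t ->
    (forall k : 'I_n,
       (\sum_(j < n) \prod_(i < n | i != j) alpha (lshift m i))
         * qr (lshift m k) t
       = (\prod_(i < n | i != k) alpha (lshift m i))
           * ((\sum_(i < m) ql (rshift n i) t)
              - \sum_(i < n | i != k) ql (lshift m i) t)
         + ((\sum_(j < n) \prod_(i < n | i != j) alpha (lshift m i))
            - \prod_(i < n | i != k) alpha (lshift m i))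
             * ql (lshift m k) t)
    /\ (forall j : 'I_m,
          pl (rshift n j) t = pr (lshift m (Ordinal hn)) t).
Proof.
move=> t Tt; have [prE prpl flow] := hmatch t Tt; split=> [k|j]; last by exact: esym (prpl _ _).
have ax (i j : 'I_n) : alpha (lshift m i) * (qr (lshift m i) t - ql (lshift m i) t)
    = alpha (lshift m j) * (qr (lshift m j) t - ql (lshift m j) t).
  have [_ _ <- _] := hdyn (lshift m i) t Tt.
  have [_ _ <- _] := hdyn (lshift m j) t Tt.
  (* Equal pressures at [t] alone would not suffice: matching is used at every time [s] in [T]. *)
  apply: (derive1_eq_on_open hT) => // s; rewrite inE => Ts.
  by have [prEs _ _] := hmatch s Ts; exact: prEs.
have := sum_prod_except k ax.
(* Flow conservation removes the outflows [qr] from the sum; the inflow of pipe [k] is split off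
   because the formula lists it separately. *)
rewrite sumrB flow [\sum_(i < n) ql _ t](bigD1 k) //= => E.
(* Writing [qr] as [(qr - ql) + ql] adds the full sum of products times [ql] of pipe [k]; the
   split-off term subtracts one product, hence the difference as coefficient. *)
by rewrite -[qr _ t](subrK (ql (lshift m k) t)) mulrDr E; ring.
Qed.
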